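(* (1) Fix an integer $K\ge 1$ and $0<p<1$, let $q^*=q^*(p)$ be the limiting busy-link probability and $\pi=(\pi_0,\dots,\pi_K)$ the limiting buffer distribution defined in the context. Then the throughput equals $$p(1-\pi_K)=V_T(q^* ),$$ the loss probability is $$P_{\mathrm{loss}}(p,q^* )=\pi_K=1-\frac{V_T(q^* )}{p},$$ and the average delay (latency) $D(p)=\mathbb E_\pi[B]/p=\frac1p\sum_{k=0}^K k\,\pi_k$ is, when $V_T(q^* )\ne pq^*$, $$D(p)=\frac{V_T(q^* )\,(q^*-V_T(q^* ))-q^*K\,(p-V_T(q^* ))}{p\,(V_T(q^* )-pq^* )}.$$ (2) Let $p_c\in(0,1]$ be such that for every $0<p<p_c$ the equation $V_T(q)=p$ has a minimal solution $q^*=q^*(p)$ with $p<q^*<1$. Then, for $0<p<p_c$, the infinite buffer distribution arising as the limit $K\to\infty$ of the buffer distributions of part (1) (i.e. the limit, for each fixed $k\ge 0$, of the probability of $k$ under the distribution with buffer size $K$) is the geometric distribution $$\pi_k=\Big(\frac{q^*-p}{1-p}\Big)^k\,\frac{1-q^*}{1-p},\qquad k\ge 0,$$ which has throughput $p$ and latency $$D(p)=\frac1p\sum_{k\ge0}k\,\pi_k=\frac{q^*-p}{(1-q^* )\,p}.$$ Here $q^*$ denotes the minimal solution of $V_T(q)=p$.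
   Context: Fix parameters $T>0$, $\mu>0$, $\sigma^2\ge 0$, $\kappa\ge 0$, $\delta>1$, $w>0$. The coverage probability function is $$V_T(q)=\int_0^\infty q\,\exp\Big\{-\frac{\mu T\sigma^2(\kappa+v^\delta)}{1+\kappa}-q\int_v^\infty\frac{wT(\kappa+v^\delta)}{\kappa+u^\delta+T(\kappa+v^\delta)}\,du\Big\}e^{-v}\,dv,$$ and $U(q)=V_T(q)/q$. The argument $q$ ranges over $[p,1]$. For an integer $K\ge1$ (buffer size) and $0<p<1$ (data rate), let $F(q)=1-G(U(q))$, $p\le q\le1$, with $$G(u)=\frac{u-p}{u-p\big(\frac{p(1-u)}{(1-p)u}\big)^K}$$ (understood by continuity, with value $(1-p)/(K+1-p)$, at $u=p$). The limiting busy-link probability $q^*=q^*(p)$ (which depends on $K$) is the minimal solution in $(p,1)$ of $q=F(q)$; equivalently it is the limit of $q_n=F(q_{n-1})$, $q_0=p$. The limiting buffer distribution for buffer size $K$ is the probability distribution on $\{0,\dots,K\}$ $$\pi_k=b^k\pi_0\ (0\le k\le K-1),\quad \pi_K=(1-p)b^K\pi_0,\quad \pi_0=\frac{1-q^*}{1-p},\quad b=\frac{p(1-U^* )}{(1-p)U^*},\quad U^*=\frac{V_T(q^* )}{q^*}.$$ $B$ denotes a random variable with distribution $\pi$. Terminology: the throughput for finite $K$ is $p(1-\pi_K)$, and for the infinite buffer it is the limit of this quantity as $K\to\infty$; the loss probability is $P_{\mathrm{loss}}(p,q)=1-V_T(q)/p$; the latency is $D(p)=\mathbb E_\pi[B]/p$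 (Little's formula). *)

(* Defs.v *)
From HB Require Import structures.
From mathcomp Require Import all_boot all_order all_algebra.
From mathcomp Require Import all_classical all_reals all_analysis.
Import Order.TTheory GRing.Theory Num.Theory.
Import numFieldNormedType.Exports.

Set Implicit Arguments.
Unset Strict Implicit.
Unset Printing Implicit Defensive.

Local Open Scope classical_set_scope.
Local Open Scope ring_scope.

(* Coverage probability function V_T(q).  The parameter [sigma2] is the noise
   power sigma^2.  For delta != 0, [0 `^ delta = 0], so the case v = 0 is
   rendered correctly. *)
Definition coverage (R : realType) (T mu sigma2 kappa delta w : R) (q : R) : R :=
  \int[lebesgue_measure]_(v in `[0, +oo[)
    (q * expR (- (mu * T * sigma2 * (kappa + v `^ delta) / (1 + kappa))
               - q * \int[lebesgue_measure]_(u in `[v, +oo[)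
                       (w * T * (kappa + v `^ delta) /
                        (kappa + u `^ delta + T * (kappa + v `^ delta))))
     * expR (- v)).

(* In all that follows, [V] stands for the coverage probability function. *)
Definition Ucov (R : realType) (V : R -> R) (q : R) : R := V q / q.

(* The ratio b between successive buffer probabilities, as a function of u. *)
Definition buffer_ratio (R : realType) (p u : R) : R := p * (1 - u) / ((1 - p) * u).

(* The closed form is 0 / 0 at u = p; the value there is its limit. *)
Definition Gfun (R : realType) (K : nat) (p u : R) : R :=
  if u == p then (1 - p) / (K%:R + 1 - p)
  else (u - p) / (u - p * buffer_ratio p u ^+ K).

Definition Ffun (R : realType) (V : R -> R) (K : nat) (p q : R) : R :=
  1 - Gfun K p (Ucov V q).

Definition is_least (R : realType) (A : set R) (x : R) : Prop :=
  A x /\ lbound A x.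

(* The least element of [A]; the junk value 0 if there is none. *)
Definition least (R : realType) (A : set R) : R := xget 0 (is_least A).

(* Limiting busy-link probability q^* for buffer size K and data rate p. *)
Definition busy_link (R : realType) (V : R -> R) (K : nat) (p : R) : R :=
  least [set q : R | p < q < 1 /\ q = Ffun V K p q].

(* Limiting buffer distribution on {0, ..., K}, extended by 0 to [nat]. *)
Definition buffer (R : realType) (V : R -> R) (K : nat) (p : R) (k : nat) : R :=
  let q := busy_link V K p in
  let b := buffer_ratio p (Ucov V q) in
  let pi0 := (1 - q) / (1 - p) in
  if (k < K)%N then b ^+ k * pi0
  else if k == K then (1 - p) * b ^+ K * pi0
  else 0.

Definition throughput (R : realType) (V : R -> R) (K : nat) (p : R) : R :=
  p * (1 - buffer V K p K).

Definition loss_probability (R : realType) (V : R -> R) (p q : R) : R :=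
  1 - V q / p.

Definition latency (R : realType) (V : R -> R) (K : nat) (p : R) : R :=
  (\sum_(0 <= k < K.+1) k%:R * buffer V K p k) / p.

(* Solutions of V(q) = p in the range [p, 1] of the argument of V. *)
Definition rate_solutions (R : realType) (V : R -> R) (p : R) : set R :=
  [set q : R | p <= q <= 1 /\ V q = p].

Definition geometric_buffer (R : realType) (p q : R) (k : nat) : R :=
  ((q - p) / (1 - p)) ^+ k * ((1 - q) / (1 - p)).

(* Main.v *)
Require Import Defs.
From HB Require Import structures.
From mathcomp Require Import all_boot all_order all_algebra.
From mathcomp Require Import ring lra.
From mathcomp Require Import all_classical all_reals all_analysis.
From mathcomp Require Import measurable_realfun.
Import Order.TTheory GRing.Theory Num.Theory.
Import numFieldNormedType.Exports.

Local Open Scope classical_set_scope.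
Local Open Scope ring_scope.

(** Everything rests on two facts about the coverage probability V: it is
    continuous on the positive reals, and 0 < V q < q there
    ([coverage_continuous], [coverage_bounds]).  Indeed V q / q is the integral
    of exp (- noise - q * interference) against the density exp (- v), so it is
    continuous by dominated convergence and lies in ]0, 1[; the upper bound is
    strict because the interference is positive on a set of positive measure,
    which uses that u ^ (- delta) is integrable at infinity.  The rest of the
    argument holds for every such function V.

    The function G is singular only in appearance: writing b for the buffer
    ratio, 1 - b = (u - p) / ((1 - p) u), and a geometric sum cancels u - p,
    so that 1 / G = 1 + p / ((1 - p) u) * (1 + b + ... + b ^ (K - 1))
    ([GfunE]).  Hence 0 < G < 1 - p and G is continuous, so F is continuous with
    values in ]p, 1[; the intermediate value theorem gives a fixed point, and
    fixed points form a closed set, so there is a least one.  At a fixed point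
    q the equation 1 - q = G (V q / q) rearranges to
    p * (1 - b ^ K * (1 - q)) = V q ([fixed_point_balance]), and b ^ K * (1 - q)
    is the probability of a full buffer: this is the throughput formula, from
    which the loss and the latency follow by algebra.

    For the limit, let q be the least solution of V q = p and q_K the busy-link
    probability.  Since F q <= q, there is a fixed point below q, so q_K <= q
    ([busy_link_le]).  As 1 - q_K then stays away from 0, the formula for 1 / G
    bounds 1 + b + ... + b ^ (K - 1) independently of K; so b <= 1 eventually,
    K * b ^ K is bounded, and the probability of a full buffer is O(1 / K)
    ([buffer_last_le]).  The throughput formula gives V q_K --> p.
    Below q, V stays under p, uniformly on each compact [p, q - e], which forces
    q_K --> q ([cvg_busy_link]); the ratio b then tends to (q - p) / (1 - p),
    and each buffer probability tends to the geometric one. *)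

(** * Arithmetic-geometric sums *)

Lemma arithmetic_geometric_sum (R : comPzRingType) (b : R) (n : nat) :
  (\sum_(0 <= k < n) k%:R * b ^+ k) * (1 - b) ^+ 2 =
    b * (1 - b ^+ n) - n%:R * b ^+ n * (1 - b).
Proof.
elim: n => [|n IH]; first by rewrite big_geq// expr0; ring.
by rewrite big_nat_recr//= mulrDl IH -natr1 (exprS b); ring.
Qed.

Lemma mulrn_expr_le (R : realFieldType) (b : R) (n : nat) :
  0 <= b <= 1 -> n%:R * b ^+ n <= \sum_(i < n) b ^+ i.
Proof.
move=> /andP[b0 b1]; rewrite mulr_natl -[X in _ *+ X]card_ord -sumr_const.
by apply: ler_sum => i _; rewrite ler_wiXn2l// ltnW.
Qed.

(** With s the square root of r, n * r ^ n = (n * s ^ n) * s ^ n, where the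
    first factor is bounded by the geometric series of ratio s. *)
Lemma cvg_mulrn_expr (R : realType) (r : R) :
  0 <= r < 1 -> n%:R * r ^+ n @[n --> \oo] --> (0 : R).
Proof.
move=> /andP[r0 r1]; set s := Num.sqrt r.
have s0 : 0 <= s by rewrite sqrtr_ge0.
have s1 : s < 1 by rewrite -sqrtr1 ltr_sqrt.
have s1' : 0 < 1 - s by rewrite subr_gt0.
apply: (@squeeze_cvgr _ _ _ _ (fun=> 0) (fun n => (1 - s)^-1 * s ^+ n)).
- apply: nearW => n; rewrite mulr_ge0 ?ler0n ?exprn_ge0//=.
  rewrite -(sqr_sqrtr r0) -/s -exprM mulnC exprM expr2 mulrA.
  rewrite ler_wpM2r ?exprn_ge0//.
  apply: le_trans (mulrn_expr_le _ _ _ _) _; first by rewrite s0 ltW.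
  rewrite -[leRHS]mul1r ler_pdivlMr// mulrC -opprB mulNr -subrX1 opprB.
  by rewrite gerBl exprn_ge0.
- exact: cvg_cst.
- by apply: cvg_geometric; rewrite ger0_norm.
Qed.

Lemma cvg_geometric_mean (R : realType) (r : R) : 0 <= r < 1 ->
  \sum_(0 <= k < n) k%:R * (r ^+ k * (1 - r)) @[n --> \oo] --> r / (1 - r).
Proof.
move=> r01; have /andP[r0 r1] := r01.
have r1' : 1 - r != 0 by rewrite gt_eqF// subr_gt0.
have -> : r / (1 - r) = (r * (1 - 0) - 0 * (1 - r)) / (1 - r).
  by rewrite subr0 mulr1 mul0r subr0.
have E n : \sum_(0 <= k < n) k%:R * (r ^+ k * (1 - r)) =
    (r * (1 - r ^+ n) - n%:R * r ^+ n * (1 - r)) / (1 - r).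
  under eq_bigr do rewrite mulrA.
  by rewrite -mulr_suml -arithmetic_geometric_sum expr2 mulrA mulfK.
under eq_fun do rewrite E.
apply: cvgM; last exact: cvg_cst.
apply: cvgB; last by apply: cvgM; [exact: cvg_mulrn_expr | exact: cvg_cst].
apply: cvgM; first exact: cvg_cst.
apply: cvgB; first exact: cvg_cst.
have := @cvg_geometric R 1 r; rewrite ger0_norm// => /(_ r1).
by rewrite -exprn_geometric.
Qed.

(** * The function G *)

Lemma buffer_ratioB (R : realType) (p u : R) : p < 1 -> 0 < u ->
  1 - buffer_ratio p u = (u - p) / ((1 - p) * u).
Proof.
move=> p1 u0; rewrite /buffer_ratio; field.
by rewrite gt_eqF//= gt_eqF// subr_gt0.
Qed.

Lemma buffer_ratio_ge0 (R : realType) (p u : R) : 0 < p < 1 -> 0 < u < 1 ->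
  0 <= buffer_ratio p u.
Proof.
move=> /andP[p0 p1] /andP[u0 u1].
by rewrite /buffer_ratio divr_ge0// mulr_ge0 ?subr_ge0// ltW.
Qed.

Lemma buffer_ratio_diag (R : realType) (p : R) : 0 < p < 1 ->
  buffer_ratio p p = 1.
Proof.
move=> /andP[p0 p1]; rewrite /buffer_ratio; field.
by rewrite !gt_eqF// subr_gt0.
Qed.

(** Dividing numerator and denominator of G by u - p removes the singularity at
    u = p: this form is manifestly continuous and positive. *)
Lemma GfunE (R : realType) (K : nat) (p u : R) : 0 < p < 1 -> 0 < u < 1 ->
  Gfun K p u =
    (1 + p / ((1 - p) * u) * \sum_(i < K) buffer_ratio p u ^+ i)^-1.
Proof.
move=> p01 u01; have /andP[p0 p1] := p01; have /andP[u0 u1] := u01.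
have p1' : 0 < 1 - p by rewrite subr_gt0.
have b0 := buffer_ratio_ge0 R p u p01 u01.
rewrite /Gfun; have [->|up] := eqVneq u p.
  have -> := buffer_ratio_diag R p p01.
  under eq_bigr do rewrite expr1n.
  rewrite sumr_const card_ord.
  have K0 : 0 <= K%:R :> R by [].
  field; rewrite !gt_eqF//=; first lra.
have := buffer_ratioB R p u p1 u0.
have := subrX1 (buffer_ratio p u) K.
set b := buffer_ratio p u; set S := \sum_(i < K) _ => hS hb.
have S0 : 0 <= S by apply: sumr_ge0 => i _; rewrite exprn_ge0.
have -> : u - p * b ^+ K = (u - p) * (1 + p / ((1 - p) * u) * S).
  have -> : b ^+ K = 1 - (1 - b) * S by rewrite -[b ^+ K](subrK 1) hS; ring.
  by rewrite hb; field; rewrite !gt_eqF.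
rewrite invfM mulrA divff ?mul1r// subr_eq0//.
Qed.

(** The upper bound comes from the first term of the geometric sum alone:
    1 + p / ((1 - p) u) > 1 / (1 - p) amounts to u < 1. *)
Lemma Gfun_bounds (R : realType) (K : nat) (p u : R) :
  (0 < K)%N -> 0 < p < 1 -> 0 < u < 1 -> 0 < Gfun K p u < 1 - p.
Proof.
move=> K0 p01 u01; rewrite GfunE//.
have /andP[p0 p1] := p01; have /andP[u0 u1] := u01.
have p1' : 0 < 1 - p by rewrite subr_gt0.
have b0 := buffer_ratio_ge0 R p u p01 u01.
have S1 : 1 <= \sum_(i < K) buffer_ratio p u ^+ i.
  case: K K0 => // K _; rewrite big_ord_recl expr0 lerDl.
  by apply: sumr_ge0 => i _; rewrite exprn_ge0.
have pu0 : 0 < p / ((1 - p) * u) by rewrite divr_gt0// mulr_gt0.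
set S := \sum_(_ < _) _ in S1 *.
have D : (1 - p)^-1 < 1 + p / ((1 - p) * u) * S.
  apply: (@lt_le_trans _ _ (1 + p / ((1 - p) * u))); last first.
    by rewrite lerD2l ler_peMr// ltW.
  rewrite -(subr_gt0 _^-1).
  have -> : 1 + p / ((1 - p) * u) - (1 - p)^-1 = p / (1 - p) * (u^-1 - 1).
    by field; rewrite !gt_eqF.
  by rewrite mulr_gt0 ?divr_gt0// subr_gt0 invf_gt1.
have D0 : 0 < (1 - p)^-1 by rewrite invr_gt0.
rewrite invr_gt0 (lt_trans D0 D)/= -[ltRHS]invrK ltf_pV2 ?posrE//.
exact: lt_trans D.
Qed.

(** The balance equation of the queue: the left-hand side is the rate of
    accepted packets, the right-hand side the rate of served ones. *)
Lemma fixed_point_balance (R : realType) (K : nat) (p u q : R) :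
  (0 < K)%N -> 0 < p < 1 -> 0 < u < 1 -> 1 - q = Gfun K p u ->
  p * (1 - buffer_ratio p u ^+ K * (1 - q)) = q * u.
Proof.
move=> K0 p01 u01 hq; have /andP[p0 p1] := p01; have /andP[u0 u1] := u01.
have p1' : 0 < 1 - p by rewrite subr_gt0.
have [up|up] := eqVneq u p.
  rewrite up mulrC; congr (_ * _).
  have -> := buffer_ratio_diag R p p01.
  by rewrite expr1n; ring.
have b0 := buffer_ratio_ge0 R p u p01 u01.
have D0 : u - p * buffer_ratio p u ^+ K != 0.
  have /andP[G0 _] := Gfun_bounds R K p u K0 p01 u01.
  by apply: contraTneq G0 => D0; rewrite /Gfun (negbTE up) D0 invr0 mulr0 ltxx.
have : (1 - q) * (u - p * buffer_ratio p u ^+ K) = u - p.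
  by rewrite hq /Gfun (negbTE up) divfK.
move: (buffer_ratio p u ^+ K) => x; lra.
Qed.

(** * Busy-link probability for a finite buffer *)

Lemma least_zero (R : realType) (f : R -> R) (a b : R) :
  {in `[a, b], continuous f} -> (exists2 c, c \in `[a, b] & f c = 0) ->
  exists m, is_least [set x | x \in `[a, b] /\ f x = 0] m.
Proof.
move=> cf [c cab fc0]; set S := [set x | _].
have lbS : lbound S a by move=> x [/itvP ->].
have iS : has_inf S by split; [exists c | exists a].
have lbm : lbound S (inf S) by apply: ge_inf; case: iS.
have mab : inf S \in `[a, b].
  rewrite in_itv/= lb_le_inf//=; last by case: iS.
  by apply: (@le_trans _ _ c); [exact: lbm | rewrite (itvP cab)].
exists (inf S); split => //; split => //.
apply/eqP; apply: contraT => fm0.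
have := cvgr_neq0 (f (inf S)) (cf _ mab) fm0.
rewrite nearE -nbhs_ballE => -[e /= e0 He].
have [x [xab fx0] xm] := inf_adherent e0 iS.
suff : f x != 0 by rewrite fx0 eqxx.
apply: He; rewrite /ball/= distrC ger0_norm ?ltrBlDl// subr_ge0.
exact: lbm.
Qed.

Lemma leastE (R : realType) (A : set R) (x : R) : is_least A x -> least A = x.
Proof.
move=> Ax; have [] : is_least A (least A) by apply: xgetPex; exists x.
by case: Ax => Ax lx Al ll; apply/eqP; rewrite eq_le lx// ll.
Qed.

Section CoverageLike.
Variables (R : realType) (V : R -> R).
Hypothesis V_bounds : forall q, 0 < q -> 0 < V q < q.
Hypothesis V_cont : forall q, 0 < q -> {for q, continuous V}.

Let U01 q : 0 < q -> 0 < Ucov V q < 1.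
Proof.
move=> q0; have /andP[V0 Vq] := V_bounds q q0.
by rewrite /Ucov divr_gt0//= ltr_pdivrMr// mul1r.
Qed.

Lemma Ffun_bounds K p q : (0 < K)%N -> 0 < p < 1 -> 0 < q ->
  p < Ffun V K p q < 1.
Proof.
move=> K0 p01 q0; have := Gfun_bounds R K p _ K0 p01 (U01 q q0).
by rewrite /Ffun => /andP[G0 G1]; apply/andP; split; lra.
Qed.

Lemma Ffun_continuous K p q : 0 < p < 1 -> 0 < q ->
  {for q, continuous (Ffun V K p)}.
Proof.
move=> p01 q0; have /andP[p0 p1] := p01.
have p1' : 0 < 1 - p by rewrite subr_gt0.
have /andP[u0 u1] := U01 q q0.
have cU : {for q, continuous (Ucov V)}.
  by apply: cvgM; [exact: V_cont | apply: cvgV; [rewrite gt_eqF | exact: cvg_id]].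
have cpU : {for q, continuous (fun x => ((1 - p) * Ucov V x)^-1)}.
  apply: cvgV; first by rewrite mulf_neq0// gt_eqF.
  by apply: cvgM => //; exact: cvg_cst.
have cb : {for q, continuous (fun x => buffer_ratio p (Ucov V x))}.
  apply: cvgM => //; apply: cvgM; first exact: cvg_cst.
  by apply: cvgB => //; exact: cvg_cst.
have b0 := buffer_ratio_ge0 R p _ p01 (U01 q q0).
rewrite /continuous_at /Ffun.
apply: cvgB; first exact: cvg_cst.
rewrite GfunE//; last exact: U01.
apply: cvg_trans (near_eq_cvg _) _; last first.
  apply: cvgV; last first.
    apply: cvgD; first exact: cvg_cst.
    apply: cvgM; first by apply: cvgM; [exact: cvg_cst|exact: cpU].
    apply: (cvg_big add_continuous) => i _.
    exact: (continuous_comp cb (@exprn_continuous R i _)).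
  have S0 : 0 <= \sum_(i < K) buffer_ratio p (Ucov V q) ^+ i.
    by apply: sumr_ge0 => i _; rewrite exprn_ge0.
  have d0 : 0 <= p / ((1 - p) * Ucov V q) by rewrite ltW// divr_gt0// mulr_gt0.
  have : 0 < 1 + p / ((1 - p) * Ucov V q) * \sum_(i < K) buffer_ratio p (Ucov V q) ^+ i.
    by apply: ltr_wpDr; [exact: mulr_ge0 | exact: ltr01].
  by move/lt0r_neq0.
near=> x; rewrite GfunE//; apply: U01.
by near: x; exact: (cvgr_gt q).
Unshelve. all: by end_near. Qed.

(** F maps into ]p, 1[, so q - F q is negative at p; a point r with F r <= r
    thus bounds a fixed point from above.  Taking r = 1 gives existence, and
    taking for r a solution of V r = p compares the two equations. *)
Lemma fixed_point_exists K p r : (0 < K)%N -> 0 < p < 1 -> p < r <= 1 ->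
  Ffun V K p r <= r ->
  exists q, [/\ p < q <= r, q < 1 & q = Ffun V K p q].
Proof.
move=> K0 p01 /andP[pr r1] Fr; have /andP[p0 p1] := p01.
pose h x := x - Ffun V K p x.
have ch : {within `[p, r], continuous h}.
  apply: continuous_in_subspaceT => x /set_mem/= /itvP xpr.
  have x0 : 0 < x by rewrite (lt_le_trans p0)// xpr.
  by apply: cvgB; [exact: cvg_id | exact: Ffun_continuous].
have /andP[Fp _] := Ffun_bounds K p p K0 p01 p0.
have hp : h p < 0 by rewrite subr_lt0.
have hr : 0 <= h r by rewrite subr_ge0.
have := IVT (v := 0) (ltW pr) ch.
rewrite min_l ?max_r ?(ltW hp) ?hr ?(le_trans (ltW hp))// => /(_ isT).
move=> [c cpr /eqP]; rewrite subr_eq0 => /eqP cF.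
have c0 : 0 < c by rewrite (lt_le_trans p0)// (itvP cpr).
have /andP[Fc1 Fc2] := Ffun_bounds K p c K0 p01 c0.
rewrite -cF in Fc1 Fc2; exists c; split => //.
by rewrite Fc1 (itvP cpr).
Qed.

(** A fixed point in [p, 1] is automatically in ]p, 1[, so that the least
    element may be looked for among the zeros of a continuous function on a
    closed interval. *)
Lemma busy_link_least K p : (0 < K)%N -> 0 < p < 1 ->
  is_least [set q : R | p < q < 1 /\ q = Ffun V K p q] (busy_link V K p).
Proof.
move=> K0 p01; have /andP[p0 p1] := p01; apply: xgetPex.
have pos x : x \in `[p, 1] -> 0 < x by move=> /itvP x1; rewrite (lt_le_trans p0)// x1.
have [||m [[mp /eqP]]] := least_zero R (fun x => x - Ffun V K p x) p 1.
- by move=> x xp; apply: cvgB; [exact: cvg_id | exact: Ffun_continuous (pos _ xp)].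
- have [||q [/andP[pq q1] _ qF]] := fixed_point_exists K p 1 K0 p01.
  + by rewrite p1 lexx.
  + by have /andP[_ /ltW] := Ffun_bounds K p 1 K0 p01 ltr01.
  + by exists q; rewrite ?in_itv/= ?(ltW pq)// -qF subrr.
rewrite subr_eq0 => /eqP mF lm; exists m; split.
  by split=> //; rewrite mF; exact: Ffun_bounds (pos _ mp).
move=> x [/andP[px x1] xF]; apply: lm; split; last by rewrite -xF subrr.
by rewrite in_itv/= !ltW.
Qed.

Lemma buffer_last K p : (0 < K)%N -> p < 1 ->
  buffer V K p K = buffer_ratio p (Ucov V (busy_link V K p)) ^+ K *
                   (1 - busy_link V K p).
Proof.
move=> K0 p1; rewrite /buffer ltnn eqxx.
by field; rewrite subr_eq0 gt_eqF.
Qed.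

Lemma throughputE K p : (0 < K)%N -> 0 < p < 1 ->
  throughput V K p = V (busy_link V K p).
Proof.
move=> K0 p01; have /andP[p0 p1] := p01.
have [[/andP[pq q1] qF] _] := busy_link_least K p K0 p01.
have q0 := lt_trans p0 pq.
rewrite /throughput buffer_last//.
rewrite (fixed_point_balance R K p _ (busy_link V K p))//.
- by rewrite /Ucov mulrC divfK// gt_eqF.
- exact: U01.
- by rewrite {1}qF /Ffun; ring.
Qed.

(** Both sums over the buffer are closed forms in b and b ^ K; the balance
    equation gives b ^ K in terms of q and V q, and what remains is an identity
    between rational functions. *)
Lemma latencyE K p (q := busy_link V K p) : (0 < K)%N -> 0 < p < 1 ->
  V q != p * q ->
  latency V K p =
    (V q * (q - V q) - q * K%:R * (p - V q)) / (p * (V q - p * q)).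
Proof.
move=> K0 p01 Vpq; have /andP[p0 p1] := p01.
have [[/andP[pq q1] qF] _] := busy_link_least K p K0 p01.
rewrite -/q in pq q1 qF.
have q0 := lt_trans p0 pq.
have /andP[u0 u1] := U01 q q0.
have := throughputE K p K0 p01; rewrite /throughput buffer_last// -/q.
have Vu : V q = q * Ucov V q by rewrite /Ucov mulrC divfK// gt_eqF.
rewrite /latency big_nat_recr//= buffer_last// -/q.
under eq_big_nat => k /andP[_ kK] do rewrite /buffer kK -/q mulrA.
rewrite -mulr_suml.
have := arithmetic_geometric_sum R (buffer_ratio p (Ucov V q)) K.
rewrite Vu; rewrite Vu in Vpq.
have := buffer_ratioB R p (Ucov V q) p1 u0.
have : buffer_ratio p (Ucov V q) = p * (1 - Ucov V q) / ((1 - p) * Ucov V q) by [].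
set u := Ucov V q in u0 u1 Vpq *; set b := buffer_ratio p u.
set A := \sum_(0 <= k < K) k%:R * b ^+ k; set x := b ^+ K.
move: A x => A x bE b1E AE xE.
have up : u - p != 0.
  by rewrite subr_eq0; apply: contra Vpq => /eqP ->; rewrite mulrC.
have p1' : 1 - p != 0 by rewrite gt_eqF// subr_gt0.
have q1' : 1 - q != 0 by rewrite gt_eqF// subr_gt0.
have b1 : 1 - b != 0 by rewrite b1E mulf_neq0// invr_neq0// mulf_neq0// gt_eqF.
have {}AE : A = (b * (1 - x) - K%:R * x * (1 - b)) / (1 - b) ^+ 2.
  by rewrite -AE mulfK// expf_neq0.
have {}xE : x = (p - q * u) / (p * (1 - q)).
  by rewrite -xE; field; rewrite q1' gt_eqF.
rewrite AE b1E bE xE; field.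
by rewrite up q1' p1' mulrC subr_eq0 mulrC Vpq !gt_eqF.
Qed.

(** * The infinite-buffer limit *)

(** V p < p, so a value at least p before q would yield, by the intermediate
    value theorem, a smaller solution of V q = p. *)
Lemma rate_not_met_below p q x : 0 < p < 1 ->
  is_least (rate_solutions V p) q -> p <= x < q -> V x < p.
Proof.
move=> /andP[p0 p1] [[/andP[pq q1] Vq] lq] /andP[px xq].
rewrite ltNge; apply/negP => Vx.
have cV : {within `[p, x], continuous V}.
  apply: continuous_in_subspaceT => y /set_mem/= /itvP yI.
  by apply: V_cont; rewrite (lt_le_trans p0)// yI.
have /andP[_ Vp] := V_bounds p p0.
have := IVT (v := p) px cV.
rewrite ge_min le_max (ltW Vp) Vx orbT => /(_ isT)[c cI Vc].
have : q <= c.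
  apply: lq; split => //; rewrite (itvP cI) /=.
  by rewrite (le_trans _ (ltW (lt_le_trans xq q1)))// (itvP cI).
by apply/negP; rewrite -ltNge (le_lt_trans _ xq)// (itvP cI).
Qed.

(** Where V q = p, u = p / q exceeds p and (1 - q) u = u - p.  As b <= 1 there,
    the denominator u - p b ^ K of G lies in ]0, u], so G u >= (u - p) / u =
    1 - q, that is, F q <= q. *)
Lemma busy_link_le K p q : (0 < K)%N -> 0 < p < 1 -> p < q < 1 -> V q = p ->
  busy_link V K p <= q.
Proof.
move=> K0 p01 /andP[pq q1] Vq; have /andP[p0 p1] := p01.
have q0 := lt_trans p0 pq.
have Fq : Ffun V K p q <= q.
  have uE : Ucov V q = p / q by rewrite /Ucov Vq.
  have uE' : (1 - q) * Ucov V q = Ucov V q - p.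
    by rewrite uE; field; rewrite gt_eqF.
  have pu : 0 < Ucov V q - p.
    by rewrite -uE' mulr_gt0 ?subr_gt0// uE divr_gt0.
  have b0 := buffer_ratio_ge0 R p _ p01 (U01 q q0).
  have /andP[u0 u1] := U01 q q0.
  have b1 : buffer_ratio p (Ucov V q) <= 1.
    by rewrite -subr_ge0 buffer_ratioB// ltW// divr_gt0// mulr_gt0// subr_gt0.
  have x0 := exprn_ge0 K b0.
  have x1 : buffer_ratio p (Ucov V q) ^+ K <= 1 by rewrite exprn_ile1.
  have up : p < Ucov V q by rewrite -subr_gt0.
  rewrite /Ffun /Gfun (gt_eqF up) lerBlDr -lerBlDl.
  rewrite ler_pdivlMr; last first.
    by rewrite (lt_le_trans pu)// lerB// ler_piMr// ltW.
  by rewrite -uE' ler_wpM2l ?subr_ge0 ?(ltW q1)// gerBl mulr_ge0// ltW.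
have [|c [/andP[pc cq] c1 cF]] := fixed_point_exists K p q K0 p01 _ Fq.
  by rewrite pq ltW.
apply: le_trans cq; have [_ lK] := busy_link_least K p K0 p01.
by apply: lK; split; rewrite // pc.
Qed.

(** Let S be the sum of the b ^ i for i < K.  The fixed-point equation gives
    (1 - q_K) (1 + p / ((1 - p) u) S) = 1, hence (1 - q_K) S <= (1 - p) / p
    because u < 1.  If b > 1, then S >= K, which the hypothesis on K excludes;
    otherwise S >= K b ^ K, which bounds b ^ K (1 - q_K). *)
Lemma buffer_last_le K p q : (0 < K)%N -> 0 < p < 1 -> q < 1 ->
  busy_link V K p <= q -> (1 - p) / p < (1 - q) * K%:R ->
  0 <= buffer V K p K <= (1 - p) / p / K%:R.
Proof.
move=> K0 p01 q1 qKq Klarge; have /andP[p0 p1] := p01.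
have [[/andP[pqK qK1] qKF] _] := busy_link_least K p K0 p01.
rewrite buffer_last//; set qK := busy_link V K p in qKq pqK qK1 qKF *.
have qK0 := lt_trans p0 pqK.
have b0 := buffer_ratio_ge0 R p _ p01 (U01 _ qK0).
have /andP[u0 u1] := U01 _ qK0.
rewrite mulr_ge0 ?exprn_ge0 ?subr_ge0 ?(ltW qK1)//= ler_pdivlMr ?ltr0n//.
have qK1' : 0 < 1 - qK by rewrite subr_gt0.
have p1' : 0 < 1 - p by rewrite subr_gt0.
have GE : 1 - qK = Gfun K p (Ucov V qK) by rewrite {1}qKF /Ffun; ring.
move: GE; rewrite GfunE//; last exact: U01.
set u := Ucov V qK in b0 u0 u1 *; set b := buffer_ratio p u in b0 *.
set S := \sum_(i < K) _ => GE.
have S0 : 0 <= S by apply: sumr_ge0 => i _; rewrite exprn_ge0.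
have SE : (1 - qK) * S <= (1 - p) / p.
  have : (1 - qK) * (1 + p / ((1 - p) * u) * S) = 1.
    by rewrite GE mulVf// lt0r_neq0// -invr_gt0 -GE.
  rewrite ler_pdivlMr// => E1.
  have E2 : (1 - qK) * S * p <= (1 - qK) * (p / ((1 - p) * u) * S) * (1 - p).
    have -> : (1 - qK) * (p / ((1 - p) * u) * S) * (1 - p) =
      ((1 - qK) * S * p) / u by field; rewrite !gt_eqF.
    rewrite ler_peMr ?mulr_ge0 ?(ltW p0) ?(ltW qK1')//.
    by rewrite invf_ge1// ltW.
  apply: le_trans E2 _; rewrite -[leRHS]mul1r ler_wpM2r ?(ltW p1')//.
  by rewrite -[leRHS]E1 mulrDr mulr1 lerDr ltW.
have [b1|b1] := leP b 1.
  apply: le_trans SE; rewrite mulrAC mulrC ler_wpM2l ?(ltW qK1')// mulrC.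
  by apply: mulrn_expr_le; rewrite b0.
suff : (1 - q) * K%:R <= (1 - p) / p by rewrite leNgt Klarge.
apply: le_trans SE; apply: ler_pM; rewrite ?subr_ge0 ?(ltW q1)// ?lerD2l ?lerN2//.
rewrite -[X in X%:R]card_ord -sumr_const.
by apply: ler_sum => i _; rewrite exprn_ege1// ltW.
Qed.
Section Limit.
Variables p q : R.
Hypotheses (p01 : 0 < p < 1) (pq1 : p < q < 1).
Hypothesis q_least : is_least (rate_solutions V p) q.

Lemma cvg_buffer_last : buffer V K p K @[K --> \oo] --> 0.
Proof.
have /andP[p0 p1] := p01; have /andP[pq q1] := pq1.
have q1' : 0 < 1 - q by rewrite subr_gt0.
apply: (@squeeze_cvgr _ _ _ _ (fun=> 0) (fun K => (1 - p) / p / K%:R)).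
- near=> K; have K0 : (0 < K)%N by near: K; exact: nbhs_infty_gt.
  apply: (buffer_last_le K p q) => //.
    by apply: busy_link_le => //; case: q_least => -[].
  rewrite -ltr_pdivrMl//; near: K; exact: nbhs_infty_gtr.
- exact: cvg_cst.
- rewrite -[X in _ --> X](mulr0 ((1 - p) / p)); apply: cvgM; first exact: cvg_cst.
  apply/gtr0_cvgV0; last exact: cvgr_idn.
  by near=> K; rewrite ltr0n; near: K; exact: nbhs_infty_gt.
Unshelve. all: by end_near. Qed.

Lemma cvg_throughput : throughput V K p @[K --> \oo] --> p.
Proof.
rewrite -[X in _ --> X]mulr1 -[X in _ --> X](congr1 ( *%R p) (subr0 1)).
apply: cvgM; first exact: cvg_cst.
by apply: cvgB; [exact: cvg_cst | exact: cvg_buffer_last].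
Qed.

Lemma cvg_coverage_busy_link : V (busy_link V K p) @[K --> \oo] --> p.
Proof.
apply: cvg_trans (near_eq_cvg _) cvg_throughput.
by near=> K; rewrite throughputE//; near: K; exact: nbhs_infty_gt.
Unshelve. all: by end_near. Qed.

(** V attains its maximum over [p, q - e], and that maximum is below p; since
    V q_K tends to p, q_K must eventually leave this interval. *)
Lemma cvg_busy_link : busy_link V K p @[K --> \oo] --> q.
Proof.
have /andP[p0 p1] := p01; have /andP[pq q1] := pq1.
apply/cvgrPdist_lt => e e0; set a := Num.max p (q - e).
have pa : p <= a by rewrite le_max lexx.
have aq : a < q by rewrite gt_max pq ltrBlDr ltrDl.
have cV : {within `[p, a], continuous V}.
  apply: continuous_in_subspaceT => y /set_mem/= /itvP yI.
  by apply: V_cont; rewrite (lt_le_trans p0)// yI.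
have [c cI Vc] := EVT_max pa cV.
have Vcp : V c < p.
  apply: rate_not_met_below q_least _ => //.
  by rewrite (itvP cI) (le_lt_trans _ aq)// (itvP cI).
near=> K.
have K0 : (0 < K)%N by near: K; exact: nbhs_infty_gt.
have qKq : busy_link V K p <= q by apply: busy_link_le => //; case: q_least => -[].
rewrite ger0_norm ?subr_ge0// ltrBlDr -ltrBlDl.
apply: (@le_lt_trans _ _ a); first by rewrite le_max lexx orbT.
rewrite ltNge; apply/negP => qKa.
have [[/andP[pqK _] _] _] := busy_link_least K p K0 p01.
have : V (busy_link V K p) <= V c by apply: Vc; rewrite in_itv/= ltW.
apply/negP; rewrite -ltNge; near: K.
exact: (cvgr_gt p cvg_coverage_busy_link).
Unshelve. all: by end_near. Qed.

Lemma cvg_buffer k : buffer V K p k @[K --> \oo] --> geometric_buffer p q k.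
Proof.
have /andP[p0 p1] := p01; have /andP[pq q1] := pq1.
have q0 := lt_trans p0 pq.
have p1' : 1 - p != 0 by rewrite gt_eqF// subr_gt0.
have cu : Ucov V (busy_link V K p) @[K --> \oo] --> p / q.
  apply: cvgM; first exact: cvg_coverage_busy_link.
  by apply: cvgV; [rewrite gt_eqF|exact: cvg_busy_link].
have cb : buffer_ratio p (Ucov V (busy_link V K p)) @[K --> \oo] --> (q - p) / (1 - p).
  have -> : (q - p) / (1 - p) = p * (1 - p / q) / ((1 - p) * (p / q)).
    by field; rewrite p1' !gt_eqF.
  apply: cvgM.
    by apply: cvgM; [exact: cvg_cst | apply: cvgB => //; exact: cvg_cst].
  apply: cvgV; first by rewrite mulf_neq0// gt_eqF// divr_gt0.
  by apply: cvgM => //; exact: cvg_cst.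
apply: cvg_trans (near_eq_cvg _) _; last first.
  apply: cvgM; first exact: (continuous_cvg _ (@exprn_continuous R k _) cb).
  apply: cvgM; last exact: cvg_cst.
  by apply: cvgB; [exact: cvg_cst|exact: cvg_busy_link].
near=> K; rewrite /buffer ifT//; near: K; exact: nbhs_infty_gt.
Unshelve. all: by end_near. Qed.
End Limit.
End CoverageLike.

(** * Weighted Laplace transforms *)

Lemma Rintegral_gt0 d (T : measurableType d) (R : realType)
    (mu : {measure set T -> \bar R}) (D A : set T) (f : T -> R) :
  measurable D -> measurable A -> A `<=` D -> mu A != 0%E ->
  mu.-integrable D (EFin \o f) ->
  (forall x, D x -> 0 <= f x) -> (forall x, A x -> 0 < f x) ->
  0 < \int[mu]_(x in D) f x.
Proof.
move=> mD mA AD A0 fi f0 fA.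
rewrite lt_neqAle Rintegral_ge0// andbT; apply: contra A0 => /eqP I0.
have : (\int[mu]_(x in D) `|(EFin \o f) x| = 0)%E.
  under eq_integral => x /set_mem Dx do rewrite /= ger0_norm ?f0//.
  have fin := integrable_fin_num mD fi.
  by rewrite -[LHS]fineK//; move: I0; rewrite /Rintegral => <-.
move/(ae_eq_integral_abs _ mD (measurable_int _ fi)) => ae.
have NA : mu.-negligible A.
  apply: negligibleS ae => x Ax /= H.
  have := fA x Ax; rewrite -lte_fin.
  by have /= -> := H (AD _ Ax); rewrite ltxx.
by apply/eqP; apply/negligibleP.
Qed.

(** The integral of exp (- a - q J) g, as a function of q >= 0: for nonnegative
    a and J the weight g dominates the integrand. *)
Section WeightedLaplace.
Context d (T : measurableType d) (R : realType).
Variables (mu : {measure set T -> \bar R}) (D : set T) (mD : measurable D).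
Variables (a J g : T -> R).
Hypothesis g_int : mu.-integrable D (EFin \o g).
Hypothesis g_gt0 : forall x, D x -> 0 < g x.
Hypotheses (ma : measurable_fun D a) (mJ : measurable_fun D J).
Hypotheses (a_ge0 : forall x, D x -> 0 <= a x) (J_ge0 : forall x, D x -> 0 <= J x).

Let h q x := expR (- a x - q * J x) * g x.

Let h_bounds q x : 0 <= q -> D x -> 0 < h q x <= g x.
Proof.
move=> q0 Dx; rewrite /h mulr_gt0 ?expR_gt0 ?g_gt0//=.
rewrite ler_piMl ?(ltW (g_gt0 _ _))// -expR0 ler_expR.
by rewrite -opprD oppr_le0 addr_ge0 ?a_ge0// mulr_ge0 ?J_ge0.
Qed.

Lemma laplace_integrable q : 0 <= q -> mu.-integrable D (EFin \o h q).
Proof.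
move=> q0; apply: (le_integrable mD) g_int.
- apply/measurable_EFinP; apply: measurable_funM.
    apply: measurableT_comp => //; apply: measurable_funB.
      exact: measurableT_comp.
    by apply: measurable_funM => //; exact: measurable_cst.
  exact/measurable_EFinP/(measurable_int _ g_int).
- move=> x Dx; have /andP[h0 hg] := h_bounds q x q0 Dx.
  by rewrite lee_fin !ger0_norm// ltW// g_gt0.
Qed.

Lemma laplace_gt0 q : 0 <= q -> mu D != 0%E -> 0 < \int[mu]_(x in D) h q x.
Proof.
move=> q0 D0; apply: (@Rintegral_gt0 _ _ _ mu D D) => //.
- exact: laplace_integrable.
- by move=> x Dx; have /andP[/ltW] := h_bounds q x q0 Dx.
- by move=> x Dx; have /andP[] := h_bounds q x q0 Dx.
Qed.

(** Strictness comes from the set A of positive measure on which J > 0: the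
    integrand of the difference is nonnegative on D and positive on A. *)
Lemma laplace_lt q (A : set T) : 0 < q -> measurable A -> A `<=` D ->
  mu A != 0%E -> (forall x, A x -> 0 < J x) ->
  \int[mu]_(x in D) h q x < \int[mu]_(x in D) g x.
Proof.
move=> q0 mA AD A0 J0; rewrite -subr_gt0.
have hi := laplace_integrable q (ltW q0).
rewrite -RintegralB//; apply: (@Rintegral_gt0 _ _ _ mu D A) => //.
- exact: (integrableB mD g_int hi).
- by move=> x Dx; have /andP[_] := h_bounds q x (ltW q0) Dx; rewrite subr_ge0.
- move=> x Ax; rewrite subr_gt0 /h -[ltRHS]mul1r ltr_pM2r ?g_gt0//; last exact: AD.
  rewrite -expR0 ltr_expR -opprD oppr_lt0 ltr_wpDl ?a_ge0//; first exact: AD.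
  by rewrite mulr_gt0// J0.
Qed.

Lemma laplace_continuous q : 0 < q ->
  {for q, continuous (fun q => \int[mu]_(x in D) h q x)}.
Proof.
move=> q0.
apply: (@continuity_under_integral R d T mu h D mD 0 (q + 1) _ _ g g_int).
- by move=> x /=; rewrite in_itv/= => /andP[x0 _]; apply: laplace_integrable; exact: ltW.
- apply: aeW => x Dx y _; apply: cvgM; last exact: cvg_cst.
  apply: continuous_comp; last exact: continuous_expR.
  apply: cvgB; first exact: cvg_cst.
  by apply: cvgM; [exact: cvg_id | exact: cvg_cst].
- move=> y /=; rewrite in_itv/= => /andP[/ltW y0 _]; apply: aeW => x Dx.
  by have /andP[h0 hg] := h_bounds y x y0 Dx; rewrite ger0_norm// ltW.
- by rewrite inE/= in_itv/= q0 ltrDl ltr01.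
Qed.
End WeightedLaplace.

(** * The coverage probability *)

Section Coverage.
Variable R : realType.
Notation leb := (@lebesgue_measure R).

Lemma expRN_integrable :
  leb.-integrable `[0, +oo[ (EFin \o (fun v => expR (- v))).
Proof.
have := @integrable_exponential_pdf R 1 ltr01.
move=> H; apply/integrable_mkcond => //; apply: eq_integrable H => // x _.
rewrite /exponential_pdf /= /patch; case: ifP => // _.
by rewrite mul1r mulN1r.
Qed.

Lemma Rintegral_expRN : \int[leb]_(v in `[0, +oo[) expR (- v) = 1.
Proof.
rewrite /Rintegral integral_mkcond.
rewrite -[RHS]/(fine 1%E) -(@integral_exponential_pdf R 1 ltr01); congr fine.
apply: eq_integral => x _.
rewrite /exponential_pdf /= /patch; case: ifP => // _.
by rewrite mul1r mulN1r.
Qed.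

Lemma powR_cvgy (s : R) : 0 < s -> x `^ s @[x --> +oo] --> +oo.
Proof.
move=> s0; apply/cvgryPge => A; near=> x.
set B := Num.max 1 A.
have B0 : 0 <= B by rewrite le_max ler01.
have Bx : B `^ s^-1 <= x by near: x; apply: nbhs_pinfty_ge; exact: num_real.
apply: (@le_trans _ _ B); first by rewrite le_max lexx orbT.
rewrite -[leLHS]powRr1// -[X in _ `^ X](mulVf (lt0r_neq0 s0)) powRrM.
by apply: ge0_ler_powR; rewrite ?nnegrE ?powR_ge0 ?(ltW s0)// (le_trans _ Bx)// powR_ge0.
Unshelve. all: by end_near. Qed.

Lemma continuous_powR (a x : R) : 0 < x ->
  {for x, continuous (fun y : R => y `^ a)}.
Proof.
move=> x0; apply: (@differentiable_continuous R R^o R^o).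
by apply/derivable1_diffP; apply: derivable_powR; rewrite in_itv/= andbT.
Qed.

Lemma powRN_integrable (delta v : R) : 1 < delta -> 0 < v ->
  leb.-integrable `[v, +oo[ (EFin \o (fun u => u `^ (- delta))).
Proof.
move=> d1 v0; apply/integrableP; split.
  apply/measurable_EFinP; apply: measurable_funTS; exact: measurable_powR.
under eq_integral => x _ do rewrite /= ger0_norm ?powR_ge0//.
have d0 : 1 - delta != 0 by rewrite lt_eqF// subr_lt0.
rewrite (@ge0_continuous_FTC2y R (fun u => u `^ (- delta))
  (fun u => (1 - delta)^-1 * u `^ (1 - delta)) v 0) ?ltry//.
- by move=> x _; exact: powR_ge0.
- apply: continuous_in_subspaceT => x; rewrite inE/= in_itv/= andbT => vx.
  by apply: continuous_powR; exact: lt_le_trans vx.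
- rewrite -[X in _ --> X](mulr0 (1 - delta)^-1); apply: cvgM; first exact: cvg_cst.
  under eq_fun do rewrite -(opprB delta) powRN.
  apply/gtr0_cvgV0; last by apply: powR_cvgy; rewrite subr_gt0.
  near=> x; apply: powR_gt0; near: x; apply: nbhs_pinfty_gt; exact: num_real.
- move=> x vx; apply: derivableM; first exact: derivable_cst.
  by apply: derivable_powR; rewrite in_itv/= andbT (lt_trans v0).
- apply: cvgM; first exact: cvg_cst.
  by apply: cvg_at_right_filter; exact: continuous_powR.
- move=> x; rewrite in_itv/= andbT => vx.
  have x0 : 0 < x by exact: lt_trans vx.
  rewrite derive1Ml; last by apply: derivable_powR; rewrite in_itv/= andbT.
  rewrite powR_derive1 ?in_itv/= ?andbT// mulrA mulVf// mul1r.
  by congr (_ `^ _); ring.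
Unshelve. all: by end_near. Qed.

Variables (T kappa delta w : R).
Hypotheses (T0 : 0 < T) (k0 : 0 <= kappa) (d1 : 1 < delta) (w0 : 0 < w).

Let kern (v u : R) : R :=
  w * T * (kappa + v `^ delta) / (kappa + u `^ delta + T * (kappa + v `^ delta)).

Let pathloss_ge0 x : 0 <= kappa + x `^ delta.
Proof. by rewrite addr_ge0// powR_ge0. Qed.

Let den_ge0 v u : 0 <= kappa + u `^ delta + T * (kappa + v `^ delta).
Proof. by rewrite addr_ge0// mulr_ge0// ltW. Qed.

Let kern_ge0 v u : 0 <= kern v u.
Proof. by rewrite /kern divr_ge0// mulr_ge0// ltW// mulr_gt0. Qed.

Let kern_measurable :
  measurable_fun setT
    (fun z : R * R => kern z.1 z.2).
Proof.
have m1 : measurable_fun setT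
    (fun z : R * R => kappa + z.1 `^ delta).
  apply: measurable_funD => //.
  by apply: (measurableT_comp (measurable_powR _)).
have m2 : measurable_fun setT
    (fun z : R * R => kappa + z.2 `^ delta).
  apply: measurable_funD => //.
  by apply: (measurableT_comp (measurable_powR _)).
(* the denominator is nonnegative, so its inverse is its power of exponent -1,
   and power functions are measurable *)
rewrite /kern; under eq_fun do rewrite -powR_inv1//.
apply: measurable_funM; first exact: measurable_funM.
apply: (measurableT_comp (measurable_powR _)).
by apply: measurable_funD => //; exact: measurable_funM.
Qed.

(** The domain of integration depends on v; extending the kernel by 0 below the
    diagonal makes this a section integral of a measurable nonnegative function
    of two variables, to which the theorem of Tonelli applies. *)
Lemma interference_measurable :
  measurable_fun setT
    (fun v : measurableTypeR R => \int[leb]_(u in `[v, +oo[) kern v u).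
Proof.
pose f (z : measurableTypeR R * measurableTypeR R) : \bar R :=
  (if z.1 <= z.2 then kern z.1 z.2 else 0)%:E.
have -> : (fun v => \int[leb]_(u in `[v, +oo[) kern v u) = fine \o fubini_F leb f.
  apply/funext => v; rewrite /= /Rintegral integral_mkcond; congr fine.
  apply: eq_integral => u _; rewrite /f /patch mem_setE in_itv/= andbT.
  by case: ifP.
apply: measurableT_comp => //; apply: measurable_fun_fubini_tonelli_F; last first.
  by move=> z; rewrite /f; case: ifP => // _; rewrite lee_fin.
apply/measurable_EFinP; apply: measurable_fun_ifT => //.
exact: measurable_fun_ler.
Qed.

(** The real-valued integral vanishes when the integral diverges, so positivity
    needs integrability: the kernel is at most a constant times u ^ (- delta). *)
Lemma interference_gt0 v : 1 <= v -> 0 < \int[leb]_(u in `[v, +oo[) kern v u.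
Proof.
move=> v1; have v0 : 0 < v by rewrite (lt_le_trans _ v1).
have Kv : 0 < kappa + v `^ delta by rewrite ltr_wpDl// powR_gt0.
have wTK : 0 < w * T * (kappa + v `^ delta) by rewrite mulr_gt0// mulr_gt0.
apply: (@Rintegral_gt0 _ _ _ leb `[v, +oo[ `[v, +oo[) => //.
- have E := lebesgue_measure_itv (`[v, +oo[ : interval R).
  by apply/eqP => /(etrans (esym E)); rewrite /= ltry.
- have := integrableZl _ (w * T * (kappa + v `^ delta))
    (powRN_integrable delta v d1 v0).
  move=> /(_ (measurable_itv _)); apply: le_integrable => //.
    apply/measurable_EFinP; apply: measurable_funTS.
    exact: (measurable_fun_pair2 v kern_measurable).
  move=> u /=; rewrite in_itv/= andbT => vu.
  have u0 : 0 < u by exact: lt_le_trans vu.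
  rewrite lee_fin (ger0_norm (kern_ge0 v u)) ger0_norm ?(mulr_ge0 (ltW wTK)) ?powR_ge0//.
  have ud : 0 < u `^ delta by exact: powR_gt0.
  have den : u `^ delta <= kappa + u `^ delta + T * (kappa + v `^ delta).
    by rewrite addrAC lerDr addr_ge0// mulr_ge0// ltW.
  by rewrite /kern ler_wpM2l ?(ltW wTK)// powRN lef_pV2// posrE (lt_le_trans ud).
- move=> u /=; rewrite in_itv/= andbT => vu.
  by rewrite /kern divr_gt0// ltr_wpDl// mulr_gt0.
Qed.

Variables (mu sigma2 : R).
Hypotheses (mu0 : 0 < mu) (s0 : 0 <= sigma2).

Let noise (v : R) : R := mu * T * sigma2 * (kappa + v `^ delta) / (1 + kappa).
Let J (v : R) : R := \int[leb]_(u in `[v, +oo[) kern v u.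
Let U (q : R) : R :=
  \int[leb]_(v in `[0, +oo[) (expR (- noise v - q * J v) * expR (- v)).

Let noise_ge0 v : 0 <= noise v.
Proof.
by rewrite divr_ge0 ?addr_ge0// mulr_ge0// mulr_ge0// mulr_ge0// ltW.
Qed.

Let J_ge0 v : 0 <= J v.
Proof. by apply: Rintegral_ge0. Qed.

Let noise_measurable : measurable_fun setT noise.
Proof.
apply: measurable_funM => //; apply: measurable_funM => //.
by apply: measurable_funD => //; exact: measurable_powR.
Qed.

Let U_integrable q : 0 <= q -> leb.-integrable `[0, +oo[
  (EFin \o (fun v => expR (- noise v - q * J v) * expR (- v))).
Proof.
move=> q0; apply: laplace_integrable => //.
- exact: expRN_integrable.
- by move=> v _; exact: expR_gt0.
- exact: measurable_funTS noise_measurable.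
- exact: measurable_funTS interference_measurable.
Qed.

Lemma coverageE q : 0 < q -> coverage T mu sigma2 kappa delta w q = q * U q.
Proof.
move=> q0; rewrite /coverage.
under eq_Rintegral do rewrite -mulrA.
rewrite RintegralZl//; exact: U_integrable (ltW q0).
Qed.

Lemma coverage_bounds q : 0 < q -> 0 < coverage T mu sigma2 kappa delta w q < q.
Proof.
move=> q0; rewrite coverageE// pmulr_rgt0// gtr_pMr//.
have D0 : leb `[0, +oo[ != 0%E.
  have E := lebesgue_measure_itv (`[0, +oo[ : interval R).
  by apply/eqP => /(etrans (esym E)); rewrite /= ltry.
have A0 : leb `[1, 2] != 0%E.
  have E := lebesgue_measure_itv (`[1, 2] : interval R).
  apply/eqP => /(etrans (esym E)); rewrite /= lte_fin ltr1n -EFinB => -[/eqP].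
  by rewrite subr_eq0 gt_eqF// ltr1n.
apply/andP; split.
  apply: laplace_gt0 => //; rewrite ?(ltW q0)//.
  - exact: expRN_integrable.
  - by move=> v _; exact: expR_gt0.
  - exact: measurable_funTS noise_measurable.
  - exact: measurable_funTS interference_measurable.
rewrite -Rintegral_expRN.
apply: (laplace_lt _ _ _ leb `[0, +oo[ _ noise J (fun v => expR (- v))
  _ _ _ _ _ _ q `[1, 2]) => //.
- exact: expRN_integrable.
- by move=> v _; exact: expR_gt0.
- exact: measurable_funTS noise_measurable.
- exact: measurable_funTS interference_measurable.
- by move=> v /=; rewrite !in_itv/= andbT => /andP[v1 _]; rewrite (le_trans _ v1).
- by move=> v /=; rewrite in_itv/= => /andP[v1 _]; exact: interference_gt0.
Qed.

Lemma coverage_continuous q : 0 < q ->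
  {for q, continuous (coverage T mu sigma2 kappa delta w)}.
Proof.
move=> q0.
have cU : x * U x @[x --> q] --> coverage T mu sigma2 kappa delta w q.
  rewrite coverageE//; apply: cvgM; first exact: cvg_id.
  apply: (laplace_continuous _ _ _ leb `[0, +oo[ _ noise J (fun v => expR (- v))) => //.
  - exact: expRN_integrable.
  - by move=> v _; exact: expR_gt0.
  - exact: measurable_funTS noise_measurable.
  - exact: measurable_funTS interference_measurable.
apply: cvg_trans (near_eq_cvg _) cU.
near=> x; rewrite /= coverageE//; near: x; exact: (cvgr_gt q).
Unshelve. all: by end_near. Qed.
End Coverage.

Theorem corollary1 (R : realType) (T mu sigma2 kappa delta w : R)
    (hT : 0 < T) (hmu : 0 < mu) (hsigma2 : 0 <= sigma2) (hkappa : 0 <= kappa)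
    (hdelta : 1 < delta) (hw : 0 < w) :
  let V := coverage T mu sigma2 kappa delta w in
  (forall (K : nat) (p : R), (1 <= K)%N -> 0 < p < 1 ->
     let q := busy_link V K p in
     [/\ throughput V K p = V q,
         loss_probability V p q = buffer V K p K,
         buffer V K p K = 1 - V q / p
       & V q != p * q ->
         latency V K p =
           (V q * (q - V q) - q * K%:R * (p - V q)) / (p * (V q - p * q))])
  /\
  (forall pc : R, 0 < pc <= 1 ->
     (forall p : R, 0 < p < pc ->
        exists q : R, p < q < 1 /\ is_least (rate_solutions V p) q) ->
     forall p : R, 0 < p < pc ->
       let q := least (rate_solutions V p) in
       [/\ forall k : nat,
             buffer V K p k @[K --> \oo] --> geometric_buffer p q k,
           throughput V K p @[K --> \oo] --> p
         & (\sum_(0 <= k < n) k%:R * geometric_buffer p q k) / p @[n --> \oo]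
             --> (q - p) / ((1 - q) * p)]).
Proof.
move=> V.
have Vb q : 0 < q -> 0 < V q < q by exact: coverage_bounds.
have Vc q : 0 < q -> {for q, continuous V} by exact: coverage_continuous.
split=> [K p K0 p01 q|pc /andP[pc0 pc1] ex p /andP[p0 ppc] q].
  have /andP[p0 p1] := p01.
  have tE : throughput V K p = V q by exact: throughputE.
  have bE : buffer V K p K = 1 - V q / p.
    by rewrite -tE /throughput; field; rewrite gt_eqF.
  by split=> //; exact: latencyE.
have p01 : 0 < p < 1 by rewrite p0 (lt_le_trans ppc).
have [q' [pq' lq']] := ex p (introT andP (conj p0 ppc)).
have qE : q = q' by exact: leastE.
rewrite {}qE; split.
- by move=> k; exact: cvg_buffer.
- exact: cvg_throughput pq' lq'.
- have /andP[pq q1] := pq'; have /andP[_ p1] := p01.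
  set r := (q' - p) / (1 - p).
  have p1' : 0 < 1 - p by rewrite subr_gt0.
  have rE : (1 - q') / (1 - p) = 1 - r by rewrite /r; field; rewrite gt_eqF.
  have r01 : 0 <= r < 1.
    by rewrite /r divr_ge0 ?subr_ge0 ?ltW//= ltr_pdivrMr// mul1r ltrD2r.
  have -> : (q' - p) / ((1 - q') * p) = r / (1 - r) / p.
    by rewrite -rE /r; field; rewrite !gt_eqF// subr_gt0.
  apply: cvgM; last exact: cvg_cst.
  rewrite /geometric_buffer rE; exact: cvg_geometric_mean.
Qed.
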